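(* Let $\varphi$ and $\psi$ be structural sets in $\mathbb{R}^m$, let $\Omega\subset\mathbb{R}^m$ be a domain, and let $f:\Omega\to\mathbb{R}_{0,m}$ be $(\varphi,\psi)$-inframonogenic in $\Omega$. Then the functions ${}^{\varphi,\psi}\Psi_+(f)$ and ${}^{\varphi,\psi}\Psi_-(f)$ are both harmonic and $(\varphi,\psi)$-inframonogenic in $\Omega$.
   Context: $\mathbb{R}_{0,m}$ is the real Clifford algebra (of dimension $2^m$) generated by the standard basis $e_1,\dots,e_m$ of $\mathbb{R}^m$ with $e_ie_j+e_je_i=-2\delta_{ij}$; $\mathbb{R}^m$ is regarded as the subspace spanned by $e_1,\dots,e_m$. A structural set is an (ordered) orthonormal basis $\psi=\{\psi^1,\dots,\psi^m\}$ of $\mathbb{R}^m$; thus $\psi^i\psi^j+\psi^j\psi^i=-2\delta_{ij}$. Reversion $a\mapsto\widehat{a}$ is the real linear anti-automorphism of $\mathbb{R}_{0,m}$ with $\widehat{e_i}=e_i$. For $A=\{j_1<\cdots<j_k\}\subset\{1,\dots,m\}$ put $\varphi_A=\varphi^{j_1}\cdots\varphi^{j_k}$, $\psi_A=\psi^{j_1}\cdots\psi^{j_k}$. For $k=1,\dots,m$ define ${}^{\varphi,\psi}\Psi_k(a)=\sum_{|A|=k}\varphi_A\,a\,\widehat{\psi_A}$ for $a\in\mathbb{R}_{0,m}$, and ${}^{\varphi,\psi}\Psi_0=I$ (the identity). Define ${}^{\varphi,\psi}\Psi_+(a)=\sum_{k\ \mathrm{even}}{}^{\varphi,\psi}\Psi_k(a)$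 and ${}^{\varphi,\psi}\Psi_-(a)=\sum_{k\ \mathrm{odd}}{}^{\varphi,\psi}\Psi_k(a)$, with sums over $0\le k\le m$. These operators act pointwise on $\mathbb{R}_{0,m}$-valued functions. A domain is an open connected set. Differentiability of $\mathbb{R}_{0,m}$-valued functions is component-wise. A $C^2$ function $f:\Omega\to\mathbb{R}_{0,m}$ is harmonic if $\Delta f=0$ in $\Omega$ ($\Delta=\sum_i\partial^2/\partial x_i^2$), and $(\varphi,\psi)$-inframonogenic if ${}^{\varphi}\underline{\partial}[f]\,{}^{\psi}\underline{\partial}=\sum_{i,j=1}^m\varphi^i\frac{\partial^2 f}{\partial x_i\partial x_j}\psi^j=0$ in $\Omega$. *)

(* Defs.v *)
From HB Require Import structures.
From mathcomp Require Import all_boot all_order all_algebra.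
From mathcomp Require Import zify ring.

Set Implicit Arguments.
Unset Strict Implicit.
Unset Printing Implicit Defensive.

Import GRing.Theory.
Local Open Scope ring_scope.

(* ------------------------------------------------------------------------ *)
(* The Clifford algebra R_{0,m}, realized on the free module with basis     *)
(* e_A, A a subset of {0, ..., m-1}, with                                   *)
(*   e_A e_B = (-1)^#{(i, j) in A x B | j <= i} e_(A symmetric-diff B):     *)
(* pairs with j < i count the transpositions needed to sort the word        *)
(* e_A e_B, and pairs with j = i count the contractions e_i e_i = -1.       *)
(* ------------------------------------------------------------------------ *)

Definition symd (m : nat) (A B : {set 'I_m}) : {set 'I_m} :=
  [set i | (i \in A) (+) (i \in B)].

Definition cinv (m : nat) (A B : {set 'I_m}) : nat :=
  (\sum_(i in A) \sum_(j in B) (j <= i))%N.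

Definition clifford (R : comNzRingType) (m : nat) : Type :=
  {ffun {set 'I_m} -> R}.

Section SymmetricDifference.
Variable m : nat.
Implicit Types A B C : {set 'I_m}.

Lemma symdC A B : symd A B = symd B A.
Proof. by apply/setP => i; rewrite !inE addbC. Qed.

Lemma symdA A B C : symd A (symd B C) = symd (symd A B) C.
Proof. by apply/setP => i; rewrite !inE addbA. Qed.

Lemma symdd A : symd A A = set0.
Proof. by apply/setP => i; rewrite !inE addbb. Qed.

Lemma sym0d A : symd set0 A = A.
Proof. by apply/setP => i; rewrite !inE. Qed.

Lemma symd0 A : symd A set0 = A.
Proof. by rewrite symdC sym0d. Qed.

Lemma symdK A B : symd A (symd A B) = B.
Proof. by rewrite symdA symdd sym0d. Qed.

Lemma odd_sum_symd (g : 'I_m -> nat) A B :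
  odd (\sum_(i in symd A B) g i) =
  odd (\sum_(i in A) g i) (+) odd (\sum_(i in B) g i).
Proof.
rewrite [X in odd X (+) _]big_mkcond [X in _ (+) odd X]big_mkcond.
rewrite -oddD -big_split /= [in LHS]big_mkcond /=.
rewrite !(big_morph odd oddD (erefl _)).
apply: eq_bigr => i _; rewrite inE oddD.
by case: (i \in A); case: (i \in B); rewrite /= ?addbb ?addbF.
Qed.

Lemma odd_card_symd A B : odd #|symd A B| = odd #|A| (+) odd #|B|.
Proof. by rewrite -!sum1_card odd_sum_symd. Qed.

Lemma odd_cinvDl A B C :
  odd (cinv (symd A B) C) = odd (cinv A C) (+) odd (cinv B C).
Proof. exact: odd_sum_symd. Qed.

Lemma odd_cinvDr A B C :
  odd (cinv A (symd B C)) = odd (cinv A B) (+) odd (cinv A C).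
Proof.
have E D : cinv A D = (\sum_(j in D) \sum_(i in A) (j <= i))%N.
  exact: exchange_big.
by rewrite !E odd_sum_symd.
Qed.

Lemma cinv0l A : cinv set0 A = 0%N.
Proof. by rewrite /cinv big_set0. Qed.

Lemma cinv0r A : cinv A set0 = 0%N.
Proof. by rewrite /cinv big1 // => i _; rewrite big_set0. Qed.

Lemma cinv_diag A : cinv A A = ('C(#|A|, 2) + #|A|)%N.
Proof.
apply: double_inj; rewrite -!addnn.
have {1}-> : cinv A A = (\sum_(i in A) \sum_(j in A) (i <= j))%N.
  exact: exchange_big.
rewrite -big_split /= (eq_bigr (fun=> #|A|.+1)); last first.
  move=> i iA; rewrite -big_split /= (eq_bigr (fun j => 1 + (j == i))%N).
    rewrite big_split /= sum1_card (bigD1 i) //= eqxx big1 ?addn0 ?addn1 //.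
    by move=> j /andP[_ /negPf ->].
  by move=> j _; rewrite -val_eqE /=; case: (ltngtP i j).
rewrite sum_nat_const addnn doubleD -!mul2n -mul_bin_diag bin1.
by case: #|A| => // n; lia.
Qed.

End SymmetricDifference.

Section CliffordAlgebra.
Variables (R : comNzRingType) (m : nat).
Local Notation Cl := (clifford R m).
Implicit Types (A B : {set 'I_m}) (x y z a b : Cl).

HB.instance Definition _ := GRing.Lmodule.copy Cl {ffun {set 'I_m} -> R^o}.

Definition csign A B : R := (-1) ^+ cinv A B.

Lemma csignDl A B C : csign (symd A B) C = csign A C * csign B C.
Proof.
by rewrite /csign -[LHS]signr_odd odd_cinvDl signr_addb !signr_odd.
Qed.

Lemma csignDr A B C : csign A (symd B C) = csign A B * csign A C.
Proof.
by rewrite /csign -[LHS]signr_odd odd_cinvDr signr_addb !signr_odd.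
Qed.

Definition cbasis A : Cl := [ffun B => (B == A)%:R].

Definition cmul x y : Cl :=
  [ffun C : {set 'I_m} =>
     \sum_(A : {set 'I_m}) csign A (symd A C) * (x A * y (symd A C))].

Lemma cmulA : associative cmul.
Proof.
move=> x y z; apply/ffunP => D; rewrite !ffunE.
transitivity (\sum_A \sum_B csign A B * csign A (symd (symd A B) D) *
  csign B (symd (symd A B) D) * (x A * y B * z (symd (symd A B) D))).
  apply: eq_bigr => A _; rewrite ffunE !mulr_sumr; apply: eq_bigr => B _.
  have -> : symd A D = symd B (symd (symd A B) D).
    by rewrite [symd A B]symdC -symdA symdK.
  by rewrite csignDr symdK; ring.
under [RHS]eq_bigr do rewrite ffunE mulr_suml mulr_sumr.
rewrite [RHS]exchange_big /=; apply: eq_bigr => A _.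
rewrite [RHS](reindex_inj (can_inj (symdK A))) /=; apply: eq_bigr => B _.
by rewrite symdK csignDl; ring.
Qed.

Lemma cmulDl : left_distributive cmul +%R.
Proof.
move=> x y z; apply/ffunP => C; rewrite !ffunE -big_split /=.
by apply: eq_bigr => A _; rewrite ffunE mulrDl mulrDr.
Qed.

Lemma cmulDr : right_distributive cmul +%R.
Proof.
move=> x y z; apply/ffunP => C; rewrite !ffunE -big_split /=.
by apply: eq_bigr => A _; rewrite ffunE !mulrDr.
Qed.

Lemma cmul1l : left_id (cbasis set0) cmul.
Proof.
move=> x; apply/ffunP => C; rewrite ffunE (bigD1 set0) //= ffunE eqxx sym0d.
rewrite /csign cinv0l !mul1r big1 ?addr0 // => A /negPf A0.
by rewrite ffunE A0 mul0r mulr0.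
Qed.

Lemma cmul1r : right_id (cbasis set0) cmul.
Proof.
move=> x; apply/ffunP => C; rewrite ffunE (bigD1 C) //= ffunE symdd eqxx.
rewrite /csign cinv0r mul1r mulr1 big1 ?addr0 // => A AC.
rewrite ffunE; case: eqP => [/(congr1 (symd A))|]; last by rewrite !mulr0.
by rewrite symdK symd0 => CA; rewrite CA eqxx in AC.
Qed.

Lemma cone_neq0 : cbasis set0 != 0.
Proof.
apply/eqP => /ffunP /(_ set0); rewrite !ffunE eqxx => /eqP.
by rewrite oner_eq0.
Qed.

HB.instance Definition _ := GRing.Zmodule_isNzRing.Build Cl
  cmulA cmul1l cmul1r cmulDl cmulDr cone_neq0.

Lemma cscaleAl (c : R) x y : c *: (x * y) = (c *: x) * y.
Proof.
apply/ffunP => C; rewrite !ffunE scaler_sumr.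
by apply: eq_bigr => A _; rewrite !ffunE /GRing.scale /=; ring.
Qed.

Lemma cscaleAr (c : R) x y : c *: (x * y) = x * (c *: y).
Proof.
apply/ffunP => C; rewrite !ffunE scaler_sumr.
by apply: eq_bigr => A _; rewrite !ffunE /GRing.scale /=; ring.
Qed.

HB.instance Definition _ := GRing.Lmodule_isLalgebra.Build R Cl cscaleAl.
HB.instance Definition _ := GRing.Lalgebra_isAlgebra.Build R Cl cscaleAr.

Definition cgen (i : 'I_m) : Cl := cbasis [set i].

Definition cvec (v : 'rV[R]_m) : Cl := \sum_i v 0 i *: cgen i.

(* The closed form of reversion: e_A with #|A| = k is multiplied by         *)
(* (-1)^(k(k-1)/2); see crevM and crev_cgen for the defining properties.    *)
Definition crev a : Cl := [ffun A : {set 'I_m} => (-1) ^+ 'C(#|A|, 2) * a A].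

Lemma clifford_sum a : a = \sum_A a A *: cbasis A.
Proof.
apply/ffunP => B; rewrite sum_ffunE (bigD1 B) //= !ffunE eqxx big1.
  by rewrite addr0 /GRing.scale /= mulr1.
by move=> A /negPf AB; rewrite !ffunE eq_sym AB /GRing.scale /= mulr0.
Qed.

Lemma cbasisM A B : cbasis A * cbasis B = csign A B *: cbasis (symd A B).
Proof.
apply/ffunP => C; rewrite !ffunE (bigD1 A) //= big1 ?addr0; last first.
  by move=> A' /negPf A'A; rewrite !ffunE A'A mul0r mulr0.
rewrite !ffunE eqxx mul1r /GRing.scale /=.
have -> : (symd A C == B) = (C == symd A B).
  by apply/eqP/eqP => [<-|->]; rewrite symdK.
by case: eqP => [->|_]; rewrite ?symdK // !mulr0.
Qed.

Lemma cgenM (i j : 'I_m) :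
  cgen i * cgen j + cgen j * cgen i = (- 2 * (i == j)%:R)%:A.
Proof.
rewrite !cbasisM /csign /cinv !big_set1 [symd [set j] _]symdC -scalerDl.
have [<-|] := eqVneq i j.
  by rewrite symdd leqnn expr1 mulr1 -opprD -mulr2n.
rewrite -val_eqE /= mulr0 scale0r.
by case: ltngtP => // _ _; rewrite expr0 expr1 (subrr, addNr) scale0r.
Qed.

Lemma cbasis_prod A : cbasis A = \prod_(i in A) cgen i.
Proof.
rewrite -big_filter.
set s := filter _ _.
have : sorted (relpre val ltn) s.
  apply: sorted_filter; first by move=> y x z; apply: ltn_trans.
  rewrite [index_enum _]unlock -enumT -sorted_map val_enum_ord.
  exact: iota_ltn_sorted.
have {1}-> : A = [set i in s].
  by apply/setP => i; rewrite inE mem_filter mem_index_enum andbT.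
elim: s => [|i s IHs] /= is_s.
  by rewrite big_nil; congr cbasis; apply/setP => i; rewrite !inE.
have lts j : j \in s -> (i < j)%N.
  apply: (allP (order_path_min _ is_s)) => {}j k l /=; exact: ltn_trans.
rewrite big_cons -IHs ?(path_sorted is_s) // cbasisM.
rewrite /csign /cinv big_set1 big1 ?expr0 ?scale1r; last first.
  by move=> j; rewrite inE => /lts; rewrite ltnNge => /negPf ->.
congr cbasis; apply/setP => j; rewrite !inE.
by case: eqP => // ->; case: (boolP (i \in s)) => // /lts; rewrite ltnn.
Qed.

Lemma crev_is_linear : linear crev.
Proof.
move=> c x y; apply/ffunP => A; rewrite !ffunE /GRing.scale /=.
by rewrite mulrDr mulrCA.
Qed.

HB.instance Definition _ := GRing.isLinear.Build R Cl Cl *:%R crev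
  crev_is_linear.

Lemma crev_cgen i : crev (cgen i) = cgen i.
Proof.
apply/ffunP => A; rewrite !ffunE.
by case: eqP => [->|_]; rewrite ?mulr0 // cards1 mul1r.
Qed.

Lemma crevM x y : crev (x * y) = crev y * crev x.
Proof.
apply/ffunP => C; rewrite !ffunE mulr_sumr.
rewrite [RHS](reindex_inj (can_inj (symdK C))) /=; apply: eq_bigr => A _.
rewrite !ffunE.
have -> : symd (symd C A) C = A by rewrite symdC symdK.
rewrite [symd C A]symdC; move: (symd A C) (symdK A C) => B <-.
have E : (-1) ^+ 'C(#|symd A B|, 2) * csign A B =
   csign B A * (-1) ^+ 'C(#|B|, 2) * (-1) ^+ 'C(#|A|, 2) :> R.
  rewrite /csign -!exprD -[LHS]signr_odd -[RHS]signr_odd; congr (_ ^+ nat_of_bool _).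
  have bin_odd (D : {set _}) : odd 'C(#|D|, 2) = odd (cinv D D) (+) odd #|D|.
    by rewrite cinv_diag oddD addbK.
  rewrite !oddD !bin_odd !odd_cinvDl !odd_cinvDr odd_card_symd.
  move: (odd (cinv A A)) (odd (cinv A B)) (odd (cinv B A)) (odd (cinv B B)).
  by move: (odd #|A|) (odd #|B|) => [] [] [] [] [] [].
by rewrite !mulrA E; ring.
Qed.

End CliffordAlgebra.

From mathcomp Require Import all_classical all_reals all_analysis.
Import numFieldNormedType.Exports.
Local Open Scope classical_set_scope.

Definition structural_set (R : realType) (m : nat) (phi : 'I_m -> 'rV[R]_m) :=
  basis_of fullv [tuple phi i | i < m] /\
  forall i j, \sum_k phi i 0 k * phi j 0 k = (i == j)%:R.

Section Psi.
Variables (R : realType) (m : nat) (phi psi : 'I_m -> 'rV[R]_m).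
Implicit Types a : clifford R m.

(* [\prod_(i in A)] multiplies in increasing order of the indices, see      *)
(* cbasis_prod.                                                             *)
Definition structural_prod (chi : 'I_m -> 'rV[R]_m) (A : {set 'I_m}) :
  clifford R m := \prod_(i in A) cvec (chi i).

(* For k = 0 the sum reduces to the identity, see Psi0.                     *)
Definition Psi (k : nat) a : clifford R m :=
  \sum_(A : {set 'I_m} | #|A| == k)
    structural_prod phi A * a * crev (structural_prod psi A).

Definition Psi_plus a : clifford R m := \sum_(k < m.+1 | ~~ odd k) Psi k a.

Definition Psi_minus a : clifford R m := \sum_(k < m.+1 | odd k) Psi k a.

Lemma Psi0 a : Psi 0 a = a.
Proof.
rewrite /Psi (eq_bigl (pred1 finset.set0)) => [|A]; last by rewrite cards_eq0.
rewrite big_pred1_eq /structural_prod !big_set0 mul1r.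
have -> : crev (1 : clifford R m) = 1.
  apply/ffunP => A; rewrite !ffunE.
  by case: eqP => [->|_]; rewrite ?mulr0 // cards0 mul1r.
exact: mulr1.
Qed.

End Psi.

Fixpoint is_Ck (R : realType) (m : nat) (k : nat) (Omega : set 'rV[R]_m)
    (g : 'rV[R]_m -> R) : Prop :=
  (forall x, Omega x -> {for x, continuous g}) /\
  if k is k'.+1 then
    forall i : 'I_m,
      (forall x, Omega x -> derivable g x (delta_mx 0 i)) /\
      is_Ck k' Omega ('D_(delta_mx 0 i) g)
  else True.

Section Inframonogenic.
Variables (R : realType) (m : nat).
Implicit Type f : 'rV[R]_m -> clifford R m.

Definition cCk (k : nat) (Omega : set 'rV[R]_m) f : Prop :=
  forall A : {set 'I_m}, is_Ck k Omega (fun x => f x A).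

Definition cpartial (i : 'I_m) f : 'rV[R]_m -> clifford R m :=
  fun x => [ffun A : {set 'I_m} => 'D_(delta_mx 0 i) (fun y => f y A) x].

Definition harmonic_on (Omega : set 'rV[R]_m) f : Prop :=
  cCk 2 Omega f /\
  (forall x, Omega x -> \sum_i cpartial i (cpartial i f) x = 0).

Definition inframonogenic (phi psi : 'I_m -> 'rV[R]_m) (Omega : set 'rV[R]_m)
    f : Prop :=
  cCk 2 Omega f /\
  (forall x, Omega x ->
    \sum_i \sum_j
      cvec (phi i) * cpartial i (cpartial j f) x * cvec (psi j) = 0).

End Inframonogenic.

(* Main.v *)
Require Import Defs.
From HB Require Import structures.
From mathcomp Require Import all_boot all_order all_algebra.
From mathcomp Require Import ring lra.
From mathcomp Require Import all_classical all_reals all_analysis.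

Set Implicit Arguments.
Unset Strict Implicit.
Unset Printing Implicit Defensive.

Import Order.TTheory GRing.Theory Num.Theory numFieldNormedType.Exports.
Local Open Scope ring_scope.

(** The sandwich operators [T_i a = phi^i a psi^i] are involutions that commute
    with each other, because the two signs produced by moving [phi^i] past
    [phi^j] and [psi^i] past [psi^j] cancel. For a subset [A] of the indices the
    term [phi_A a rev(psi_A)] is the composite of the [T_i], [i] in [A]. Hence
    [Psi_+ + Psi_-] is the product of the [1 + T_i] and [Psi_+ - Psi_-] is the
    product of the [1 - T_i]: up to a factor, these are the projections [P] onto
    the joint eigenspaces on which every [T_i] is [1], or every [T_i] is [-1],
    and [T_i P = P T_i = +P] or [-P] accordingly ([sandwich_signed_Psi],
    [signed_Psi_sandwich]).

    Since [phi^i a psi^j = - T_i (a psi^j psi^i)], applying [P] gives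
      [P (phi^i a psi^j + phi^j a psi^i) = +-2 delta_ij P a],
    the off-diagonal part vanishing by anticommutation of the [psi^i]; the
    same formula holds with [P] applied to [a] inside instead
    ([signed_Psi_symmetrized], [symmetrized_signed_Psi]). Let [H_ij] be the
    second partial derivatives of [f] at a point, and [D] the
    inframonogenic operator, so that [D f = sum phi^i H_ij psi^j]. As [H] is
    symmetric, the two formulas say [P (D f) = +-Lap (P f)] and
    [D (P f) = +-Lap (P f)]. So [D f = 0] forces [P f] to be harmonic, and then
    inframonogenic; [Psi_+ f] and [Psi_- f] are linear combinations of the two
    functions [P f].

    The analysis that remains is the symmetry of [H], which is Schwarz's theorem
    for twice continuously differentiable functions ([mixed_deriveC]), and the
    fact that constant linear maps of the algebra commute with partial
    derivatives ([cpartial2_linear]). *)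

(** * Sandwich operators and their joint eigenprojections *)

Section CliffordFamilies.
Variables (R : numFieldType) (m : nat).
Local Notation Cl := (clifford R m).
Implicit Types (w : 'I_m -> Cl) (a : Cl) (b : bool).

Definition clifford_family w :=
  forall i j, w i * w j + w j * w i = (- 2 * (i == j)%:R)%:A.

Lemma cvecM_anticomm (p q : 'rV[R]_m) :
  cvec p * cvec q + cvec q * cvec p = (- 2 * \sum_k p 0 k * q 0 k)%:A.
Proof.
have E (x y : 'rV[R]_m) : cvec x * cvec y =
    \sum_i \sum_j (x 0 i * y 0 j) *: (cgen R i * cgen R j).
  rewrite mulr_suml; apply: eq_bigr => i _; rewrite mulr_sumr.
  by apply: eq_bigr => j _; rewrite -scalerAl -scalerAr scalerA.
rewrite !E [X in _ + X]exchange_big -big_split mulr_sumr scaler_suml /=.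
apply: eq_bigr => i _; rewrite -big_split (bigD1 i) //= big1 ?addr0 => [|j ji].
  rewrite [q 0 i * _]mulrC -scalerDr cgenM eqxx scalerA mulr1.
  by congr (_ *: _); ring.
by rewrite [q 0 j * _]mulrC -scalerDr cgenM eq_sym (negPf ji) mulr0 scale0r scaler0.
Qed.

Lemma crev_cvec (p : 'rV[R]_m) : crev (cvec p) = cvec p.
Proof.
by rewrite linear_sum; apply: eq_bigr => i _; rewrite linearZ /= crev_cgen.
Qed.

Lemma crev1 : crev (1 : Cl) = 1.
Proof.
apply/ffunP => A; rewrite !ffunE.
by case: eqP => [->|_]; rewrite ?mulr0 // cards0 mul1r.
Qed.

Lemma mulr2n_eq0 a : a *+ 2 = 0 -> a = 0.
Proof.
move=> a2; have two_neq0 : (2 : R) != 0 by rewrite pnatr_eq0.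
by apply: (scalerI two_neq0); rewrite scaler0 scaler_nat.
Qed.

Lemma clifford_family_anticomm w i j :
  clifford_family w -> i != j -> w i * w j = - (w j * w i).
Proof.
by move=> hw /negPf ij; apply/eqP; rewrite -addr_eq0 hw ij mulr0 scale0r.
Qed.

Lemma clifford_family_sqr w i : clifford_family w -> w i * w i = -1.
Proof.
move=> hw; apply/eqP; rewrite -addr_eq0; apply/eqP/mulr2n_eq0.
by rewrite mulrnDl mulr2n hw eqxx mulr1 scaleNr scaler_nat addNr.
Qed.

Definition sandwich w w' (i : 'I_m) a : Cl := w i * a * w' i.

(** The index list is explicit so that inductions can peel off one factor at a
    time. *)
Definition sandwich_prod w w' (s : seq 'I_m) (A : {set 'I_m}) a : Cl :=
  (\prod_(i <- s | i \in A) w i) * a * crev (\prod_(i <- s | i \in A) w' i).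

Variables u v : 'I_m -> Cl.
Hypotheses (u_cliff : clifford_family u) (v_cliff : clifford_family v).
Hypothesis v_rev : forall i, crev (v i) = v i.

Lemma sandwichK i a : sandwich u v i (sandwich u v i a) = a.
Proof.
rewrite /sandwich -!mulrA (clifford_family_sqr _ v_cliff) !mulrA.
by rewrite (clifford_family_sqr _ u_cliff) !mulN1r mulrN1 opprK.
Qed.

Lemma sandwichC i j a :
  sandwich u v i (sandwich u v j a) = sandwich u v j (sandwich u v i a).
Proof.
have [->//|ij] := eqVneq i j; rewrite /sandwich !mulrA.
rewrite (clifford_family_anticomm u_cliff ij) -!mulrA.
rewrite (clifford_family_anticomm (i := j) v_cliff) 1?eq_sym //.
by rewrite !mulrN mulNr opprK !mulrA.
Qed.

(** Reversion puts the factors of the right-hand product in the opposite order,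
    which is what makes the two-sided product a composite of operators. *)
Lemma sandwich_prod_cons k s A a : sandwich_prod u v (k :: s) A a =
  if k \in A then sandwich u v k (sandwich_prod u v s A a)
  else sandwich_prod u v s A a.
Proof.
rewrite /sandwich_prod /sandwich !big_cons; case: ifP => // _.
by rewrite crevM v_rev !mulrA.
Qed.

Lemma sandwich_prodC i s A a :
  sandwich_prod u v s A (sandwich u v i a) =
  sandwich u v i (sandwich_prod u v s A a).
Proof.
elim: s => [|k s IHs]; last first.
  by rewrite !sandwich_prod_cons IHs; case: ifP => // _; apply: sandwichC.
by rewrite /sandwich_prod !big_nil crev1 !mul1r !mulr1.
Qed.

(** The operators [sandwich u v i] are commuting involutions, so subsets of
    indices multiply by symmetric difference, without the signs that the
    one-sided products [u_A] would produce. *)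
Lemma sandwich_prod_symd i s A a : uniq s -> i \in s ->
  sandwich u v i (sandwich_prod u v s A a) =
  sandwich_prod u v s (symd [set i]%SET A) a.
Proof.
elim: s => //= k s IHs /andP[k_s s_uniq]; rewrite inE !sandwich_prod_cons.
have kE : (k \in symd [set i]%SET A) = (k == i) (+) (k \in A) by rewrite !inE.
rewrite kE; have [<- _|ki /= i_s] := eqVneq k i.
  (* [s] has no other occurrence of [k], so [k] only affects the head factor *)
  have -> : sandwich_prod u v s (symd [set k]%SET A) a = sandwich_prod u v s A a.
    have E w : \prod_(j <- s | j \in symd [set k]%SET A) w j =
               \prod_(j <- s | j \in A) w j :> Cl.
      rewrite big_seq_cond [RHS]big_seq_cond; apply: eq_bigl => j.
      by rewrite !inE; case: (eqVneq j k) => // ->; rewrite (negPf k_s).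
    by rewrite /sandwich_prod !E.
  by case: (k \in A) => //=; rewrite sandwichK.
by rewrite -(IHs s_uniq i_s); case: ifP => // _; rewrite sandwichC.
Qed.

(** The expansion of the product over [i] of [1 + (-1)^b T_i], with
    [T_i = sandwich u v i]. *)
Definition signed_Psi (b : bool) a : Cl :=
  \sum_(A : {set 'I_m}) (-1) ^+ (b && odd #|A|) *:
    sandwich_prod u v (index_enum _) A a.

Lemma sandwich_prod_is_linear s A : linear (sandwich_prod u v s A).
Proof.
by move=> c x y; rewrite /sandwich_prod mulrDr mulrDl -scalerAr -scalerAl.
Qed.
HB.instance Definition _ s A :=
  GRing.isLinear.Build R Cl Cl *:%R (sandwich_prod u v s A)
    (sandwich_prod_is_linear s A).

Lemma signed_Psi_is_linear b : linear (signed_Psi b).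
Proof.
move=> c x y; rewrite /signed_Psi scaler_sumr -big_split /=.
by apply: eq_bigr => A _; rewrite linearP scalerDr !scalerA mulrC.
Qed.
HB.instance Definition _ b :=
  GRing.isLinear.Build R Cl Cl *:%R (signed_Psi b) (signed_Psi_is_linear b).

(** Each factor satisfies [T_i (1 + c T_i) = c (1 + c T_i)] for [c = +-1]; on the
    expansion this is the reindexing of subsets by [A |-> symd [set i] A], which
    flips the parity of [#|A|]. *)
Lemma sandwich_signed_Psi b i a :
  sandwich u v i (signed_Psi b a) = (-1) ^+ b *: signed_Psi b a.
Proof.
rewrite /signed_Psi scaler_sumr /sandwich mulr_sumr mulr_suml.
rewrite [RHS](reindex_inj (can_inj (symdK [set i]%SET))) /=.
apply: eq_bigr => A _; rewrite -scalerAr -scalerAl.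
rewrite -/(sandwich u v i _) sandwich_prod_symd ?index_enum_uniq ?mem_index_enum //.
rewrite odd_card_symd cards1 scalerA; congr (_ *: _).
by case: b; rewrite ?expr0 ?mulr1 // -signr_addb; case: (odd _).
Qed.

Lemma signed_Psi_sandwich b i a :
  signed_Psi b (sandwich u v i a) = (-1) ^+ b *: signed_Psi b a.
Proof.
rewrite -(sandwich_signed_Psi b i) /signed_Psi [in RHS]/sandwich mulr_sumr mulr_suml.
apply: eq_bigr => A _; rewrite sandwich_prodC.
by rewrite -scalerAr -scalerAl.
Qed.

(** [u_i a v_j = - T_i (a v_j v_i)] because [v_i] squares to [-1]; once the
    operator [T_i] is absorbed into a scalar, only the anticommutator of [v_i]
    and [v_j] is left. *)
Lemma signed_Psi_symmetrized b i j a :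
  signed_Psi b (u i * a * v j + u j * a * v i) =
  ((-1) ^+ b * (2 * (i == j)%:R)) *: signed_Psi b a.
Proof.
have E k l : u k * a * v l = - sandwich u v k (a * (v l * v k)).
  by rewrite /sandwich -!mulrA (clifford_family_sqr _ v_cliff) !mulrN !mulr1 opprK.
rewrite (E i j) (E j i) linearD !linearN /= !signed_Psi_sandwich -opprD -scalerDr.
rewrite -linearD -mulrDr v_cliff -scalerAr mulr1 /= [signed_Psi b (_ *: _)]linearZ /=.
rewrite scalerA -scaleNr eq_sym.
by congr (_ *: _); ring.
Qed.

(** Here [T_i] acts on the left of [signed_Psi b a], where it is again a scalar,
    and [u_i (P a) v_j = - T_i (P a) v_i v_j]. *)
Lemma symmetrized_signed_Psi b i j a :
  u i * signed_Psi b a * v j + u j * signed_Psi b a * v i =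
  ((-1) ^+ b * (2 * (i == j)%:R)) *: signed_Psi b a.
Proof.
have E k l : u k * signed_Psi b a * v l =
    - ((-1) ^+ b *: (signed_Psi b a * (v k * v l))).
  rewrite scalerAl -(sandwich_signed_Psi b k) /sandwich !mulrA.
  by rewrite -[_ * v k * v k]mulrA (clifford_family_sqr _ v_cliff) mulrN1 mulNr opprK.
rewrite !E -opprD -scalerDr -mulrDr v_cliff -scalerAr mulr1 scalerA -scaleNr.
by congr (_ *: _); ring.
Qed.

Definition parity_Psi (o : bool) a : Cl :=
  \sum_(A : {set 'I_m} | odd #|A| == o) sandwich_prod u v (index_enum _) A a.

Lemma parity_Psi_is_linear o : linear (parity_Psi o).
Proof.
move=> c x y; rewrite /parity_Psi scaler_sumr -big_split /=.
by apply: eq_bigr => A _; rewrite linearP.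
Qed.
HB.instance Definition _ o :=
  GRing.isLinear.Build R Cl Cl *:%R (parity_Psi o) (parity_Psi_is_linear o).

(** The two signed sums separate the subsets of even and of odd size. *)
Lemma parity_Psi2 o a :
  parity_Psi o a *+ 2 = signed_Psi false a + (-1) ^+ o *: signed_Psi true a.
Proof.
rewrite /parity_Psi /signed_Psi scaler_sumr -big_split -sumrMnl big_mkcond /=.
apply: eq_bigr => A _; rewrite expr0 scale1r scalerA -signr_addb.
by case: (odd _); case: o; rewrite /= ?expr0 ?expr1 ?scale1r ?scaleN1r ?subrr -?mulr2n.
Qed.

Variable H : 'I_m -> 'I_m -> Cl.
Hypothesis H_sym : forall i j, H i j = H j i.
Hypothesis H_infra : \sum_i \sum_j u i * H i j * v j = 0.

Lemma double_sum_sandwich (G : 'I_m -> 'I_m -> Cl) :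
  (forall i j, G i j = G j i) ->
  (\sum_i \sum_j u i * G i j * v j) *+ 2 =
  \sum_i \sum_j (u i * G i j * v j + u j * G i j * v i).
Proof.
move=> G_sym; rewrite mulr2n [X in _ + X]exchange_big -big_split /=.
apply: eq_bigr => i _; rewrite -big_split; apply: eq_bigr => j _.
by rewrite [G j i]G_sym.
Qed.

Lemma scaled_diag_sum (c : R) (G : 'I_m -> 'I_m -> Cl) :
  \sum_i \sum_j (c * (2 * (i == j)%:R)) *: G i j = (c *: \sum_i G i i) *+ 2.
Proof.
rewrite scaler_sumr -sumrMnl; apply: eq_bigr => i _.
rewrite (bigD1 i) //= big1 ?addr0 => [|j ji].
  by rewrite eqxx mulr1 mulr_natr scalerMnl.
by rewrite eq_sym (negPf ji) !mulr0 scale0r.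
Qed.

(** With [H] the matrix of second partial derivatives of a function [f], this is
    the harmonicity of [signed_Psi b (f)]: apply [signed_Psi b] to the symmetrized
    form of the inframonogenic equation [H_infra]. *)
Lemma signed_Psi_trace b : \sum_i signed_Psi b (H i i) = 0.
Proof.
have sign_neq0 : (-1) ^+ b != 0 :> R by rewrite signr_eq0.
apply: (scalerI sign_neq0); rewrite scaler0; apply: mulr2n_eq0.
rewrite -(scaled_diag_sum _ (fun i j => signed_Psi b (H i j))).
transitivity (signed_Psi b ((\sum_i \sum_j u i * H i j * v j) *+ 2)); last first.
  by rewrite H_infra mul0rn raddf0.
rewrite double_sum_sandwich // raddf_sum; apply: eq_bigr => i _.
by rewrite raddf_sum; apply: eq_bigr => j _; rewrite -signed_Psi_symmetrized.
Qed.

(** The symmetrized sum collapses to its diagonal, which is the trace that was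
    just shown to vanish. *)
Lemma signed_Psi_infra b : \sum_i \sum_j u i * signed_Psi b (H i j) * v j = 0.
Proof.
apply: mulr2n_eq0.
rewrite (double_sum_sandwich (G := fun i j => signed_Psi b (H i j))); last first.
  by move=> i j; rewrite H_sym.
under eq_bigr do under eq_bigr do rewrite symmetrized_signed_Psi.
rewrite (scaled_diag_sum _ (fun i j => signed_Psi b (H i j))).
by rewrite signed_Psi_trace scaler0 mul0rn.
Qed.

Lemma parity_Psi_trace o : \sum_i parity_Psi o (H i i) = 0.
Proof.
apply: mulr2n_eq0; rewrite -sumrMnl; under eq_bigr do rewrite parity_Psi2.
by rewrite big_split -scaler_sumr /= !signed_Psi_trace scaler0 addr0.
Qed.

Lemma parity_Psi_infra o : \sum_i \sum_j u i * parity_Psi o (H i j) * v j = 0.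
Proof.
apply: mulr2n_eq0; rewrite -sumrMnl.
transitivity (\sum_i \sum_j (u i * signed_Psi false (H i j) * v j +
                (-1) ^+ o *: (u i * signed_Psi true (H i j) * v j))).
  apply: eq_bigr => i _; rewrite -sumrMnl; apply: eq_bigr => j _.
  by rewrite -mulrnAl -mulrnAr parity_Psi2 mulrDr mulrDl -scalerAr -scalerAl.
under eq_bigr do rewrite big_split -scaler_sumr /=.
by rewrite big_split -scaler_sumr /= !signed_Psi_infra scaler0 addr0.
Qed.

End CliffordFamilies.

Local Open Scope classical_set_scope.
Local Open Scope ring_scope.

(** * Symmetry of mixed directional derivatives *)

Section DerivativesAlongLines.
Variables (R : realType) (V : normedModType R).
Implicit Types (g : V -> R) (x v w : V) (s t h : R).

Lemma is_derive_line g x v s : derivable g (x + s *: v) v ->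
  is_derive s 1 (fun t => g (x + t *: v)) ('D_v g (x + s *: v)).
Proof.
have E : (fun h => h^-1 *: (((fun t => g (x + t *: v)) \o shift s) (h *: 1) -
                            g (x + s *: v))) =
         (fun h => h^-1 *: ((g \o shift (x + s *: v)) (h *: v) - g (x + s *: v))).
  apply/funext => h /=; congr (_ *: (g _ - _)).
  by rewrite [h *: 1]mulr1 scalerDl addrCA.
by move=> gv; apply: DeriveDef; rewrite /derivable /derive E.
Qed.

Lemma MVT_line g (dg : V -> R) x v h : 0 < h ->
  (forall s, s \in `[0, h] ->
     is_derive (x + s *: v) v g (dg (x + s *: v))) ->
  exists2 s, s \in `[0, h] & g (x + h *: v) - g x = h * dg (x + s *: v).
Proof.
move=> h0 gv; pose g1 t := g (x + t *: v).
have g1' s : s \in `[0, h] -> is_derive s 1 g1 (dg (x + s *: v)).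
  by move=> /gv -[gs <-]; apply: is_derive_line.
have g1_oo s : s \in `]0, h[ -> is_derive s 1 g1 (dg (x + s *: v)).
  by move=> s_h; apply/g1'/subset_itv_oo_cc.
have g1_cont : {within `[0, h], continuous g1}.
  by apply: derivable_within_continuous => s /g1' [].
have [s s_h] := MVT_segment (ltW h0) g1_oo g1_cont.
by rewrite /g1 scale0r addr0 subr0 mulrC; exists s.
Qed.

(** The mean value theorem is used twice: along [v] for the increment of [g] in
    the direction [h w], then along [w] for ['D_v g]. *)
Lemma second_difference g x v w (r h : R) : 0 < h -> h * (`|v| + `|w|) < r ->
  (forall y, ball x r y -> derivable g y v) ->
  (forall y, ball x r y -> derivable ('D_v g) y w) ->
  exists2 y, ball x r y &
    g (x + h *: v + h *: w) - g (x + h *: v) - g (x + h *: w) + g x =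
    h ^+ 2 * 'D_w ('D_v g) y.
Proof.
move=> h0 hr gv gvw.
have in_ball s t : s \in `[0, h] -> t \in `[0, h] ->
    ball x r (x + s *: v + t *: w).
  rewrite !in_itv /= => /andP[s0 sh] /andP[t0 th].
  rewrite -ball_normE /= opprD addrA opprD addNKr -opprD normrN.
  apply: le_lt_trans hr; rewrite mulrDr.
  apply: (le_trans (ler_normD _ _)); rewrite !normrZ !ger0_norm //.
  by apply: lerD; apply: ler_wpM2r.
have h_h : h \in `[0, h] by rewrite in_itv /= lexx ltW.
have h_0 : 0 \in `[0, h] by rewrite in_itv /= lexx ltW.
pose G y := g (y + h *: w) - g y.
pose G' y := 'D_v g (y + h *: w) - 'D_v g y.
have [s s_h Gs] : exists2 s, s \in `[0, h] & G (x + h *: v) - G x = h * G' (x + s *: v).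
  apply: (MVT_line (g := G) (dg := G') h0) => s s_h; apply: is_deriveB.
    have -> : (fun y => g (y + h *: w)) = g \o shift (h *: w) by [].
    have gD := gv _ (in_ball _ _ s_h h_h).
    by apply: DeriveDef; rewrite /derivable /derive; under eq_fun do rewrite /= -addrA.
  have := gv _ (in_ball _ _ s_h h_0).
  by rewrite scale0r addr0 => gD; apply: derivableP.
have [t t_h Gt] : exists2 t, t \in `[0, h] &
    'D_v g (x + s *: v + h *: w) - 'D_v g (x + s *: v) =
    h * 'D_w ('D_v g) (x + s *: v + t *: w).
  apply: (MVT_line (g := 'D_v g) (dg := 'D_w ('D_v g)) h0) => t t_h.
  by apply: derivableP; apply: gvw; apply: in_ball.
exists (x + s *: v + t *: w); first exact: in_ball.
by rewrite expr2 -mulrA -Gt -Gs /G; ring.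
Qed.

(** The second difference of [g] is symmetric in [v] and [w], so the two mixed
    derivatives take a common value at two points as close to [x] as desired;
    if they differed at [x] by [e > 0], continuity would keep each within
    [e / 2] of its value at [x] there, which is a contradiction. *)
Lemma mixed_deriveC g x v w (U : set V) : open U -> U x ->
  (forall y, U y -> derivable g y v /\ derivable g y w) ->
  (forall y, U y -> derivable ('D_v g) y w /\ derivable ('D_w g) y v) ->
  {for x, continuous ('D_w ('D_v g))} -> {for x, continuous ('D_v ('D_w g))} ->
  'D_w ('D_v g) x = 'D_v ('D_w g) x.
Proof.
move=> Uo Ux dg ddg cvw cwv; apply/eqP; rewrite -subr_eq0 -normr_eq0.
apply: contraT => ne0; set e := `|_| in ne0.
have e0 : 0 < e / 2 by rewrite divr_gt0 // lt_def ne0 normr_ge0.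
have nU : nbhs x U by apply: open_nbhs_nbhs; split.
have nvw : \forall y \near x, `|'D_w ('D_v g) x - 'D_w ('D_v g) y| < e / 2.
  by move: cvw => /cvgrPdist_lt /(_ _ e0).
have nwv : \forall y \near x, `|'D_v ('D_w g) x - 'D_v ('D_w g) y| < e / 2.
  by move: cwv => /cvgrPdist_lt /(_ _ e0).
have [r /= r0 near_r] := (nbhs_ballP _ _).1 (filterI nU (filterI nvw nwv)).
(* any step below [r / (`|v| + `|w|)]; the shift by 1 covers zero vectors *)
pose h := r / (`|v| + `|w| + 1) / 2.
have n0 : 0 < `|v| + `|w| + 1 by rewrite ltr_wpDl // addr_ge0.
have h0 : 0 < h by rewrite !divr_gt0.
have hr : h * (`|v| + `|w|) < r.
  have -> : r = h * (2 * (`|v| + `|w| + 1)).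
    by rewrite /h; field; rewrite gt_eqF.
  by rewrite ltr_pM2l //; have := normr_ge0 v; have := normr_ge0 w; lra.
have Ur y : ball x r y -> U y by move=> /near_r[].
have [|| y y_r Dy] := @second_difference g x v w r h h0 hr.
- by move=> y /Ur /dg [].
- by move=> y /Ur /ddg [].
have [||| z z_r Dz] := @second_difference g x w v r h h0.
- by rewrite addrC.
- by move=> z /Ur /dg [].
- by move=> z /Ur /ddg [].
have yz : 'D_w ('D_v g) y = 'D_v ('D_w g) z.
  have h2 : h ^+ 2 != 0 by rewrite expf_neq0 // gt_eqF.
  apply: (mulfI h2); apply: etrans (esym Dy) (etrans _ Dz).
  have -> : x + h *: w + h *: v = x + h *: v + h *: w by exact: addrAC.
  by congr (_ + _); exact: addrAC.
have [_ [Hy _]] := near_r _ y_r; have [_ [_]] := near_r _ z_r.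
rewrite distrC -yz => Hz.
have := le_lt_trans (ler_distD ('D_w ('D_v g) y) _ _) (ltrD Hy Hz).
by rewrite -splitr -/e ltxx.
Qed.
End DerivativesAlongLines.

(** * Linear maps and partial derivatives of Clifford-valued functions *)

Section SmoothFunctions.
Variables (R : realType) (m : nat) (Omega : set 'rV[R]_m).
Hypothesis Omega_open : open Omega.
Implicit Types (g : 'rV[R]_m -> R) (f : 'rV[R]_m -> clifford R m).
Local Notation Cl := (clifford R m).

Lemma near_open (P : 'rV[R]_m -> Prop) x :
  Omega x -> (forall y, Omega y -> P y) -> \forall y \near x, P y.
Proof. by move=> Ox OP; apply: filterS OP _; apply: open_nbhs_nbhs. Qed.

(** Derivatives of a function are only controlled on [Omega]; this transports
    smoothness along identities that hold on that open set alone. *)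
Lemma is_Ck_eq k g1 g2 : (forall x, Omega x -> g1 x = g2 x) ->
  is_Ck k Omega g1 -> is_Ck k Omega g2.
Proof.
elim: k g1 g2 => [|k IHk] g1 g2 g12 [g1_cont dg1]; split.
1,3: move=> x Ox; rewrite /prop_for /continuous_at -(g12 x Ox);
  apply: (cvg_trans _ (g1_cont x Ox));
  exact: (near_eq_cvg (near_open Ox (fun y Oy => g12 y Oy))).
- by [].
move=> i; have [dg1_ex dg1_Ck] := dg1 i; split.
  by move=> x Ox; exact: (near_eq_derivable (near_open Ox g12) (dg1_ex x Ox)).
by apply: IHk dg1_Ck => x Ox; exact: (near_eq_derive _ (near_open Ox g12)).
Qed.

Lemma is_Ck0 k : is_Ck k Omega (fun=> 0).
Proof.
elim: k => [|k IHk]; (split=> [x _|]; first exact: cst_continuous) => // i.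
split=> [x _|]; first exact: derivable_cst.
by apply: is_Ck_eq IHk => x _; rewrite (derive_cst (0 : R)).
Qed.

Lemma is_CkD k g1 g2 : is_Ck k Omega g1 -> is_Ck k Omega g2 ->
  is_Ck k Omega (fun x => g1 x + g2 x).
Proof.
elim: k g1 g2 => [|k IHk] g1 g2 [g1_cont dg1] [g2_cont dg2];
  (split=> [x Ox|]; first exact: cvgD (g1_cont x Ox) (g2_cont x Ox)) => // i. have [dg1_ex dg1_Ck] := dg1 i; have [dg2_ex dg2_Ck] := dg2 i; split.
  by move=> x Ox; apply: derivableD; [apply: dg1_ex|apply: dg2_ex].
apply: is_Ck_eq (IHk _ _ dg1_Ck dg2_Ck) => x Ox.
by rewrite -deriveD //; [apply: dg1_ex|apply: dg2_ex].
Qed.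

Lemma is_CkZ k (c : R) g : is_Ck k Omega g -> is_Ck k Omega (fun x => c * g x).
Proof.
elim: k g => [|k IHk] g [g_cont dg];
  (split=> [x Ox|]; first exact: cvgM (cvg_cst c) (g_cont x Ox)) => // i. have [dg_ex dg_Ck] := dg i; split.
  by move=> x Ox; apply: derivableZ; apply: dg_ex.
apply: is_Ck_eq (IHk _ dg_Ck) => x Ox.
by rewrite -[LHS]deriveZ //; apply: dg_ex.
Qed.

Lemma is_Ck_sum (I : Type) (s : seq I) k (c : I -> R) (g : I -> 'rV[R]_m -> R) :
  (forall i, is_Ck k Omega (g i)) ->
  is_Ck k Omega (fun x => \sum_(i <- s) c i * g i x).
Proof.
move=> g_Ck; elim: s => [|i s IHs].
  by under eq_fun do rewrite big_nil; apply: is_Ck0.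
under eq_fun do rewrite big_cons.
by apply: is_CkD => //; apply: is_CkZ.
Qed.

Lemma is_derive_linear_comb (I : Type) (s : seq I) (c : I -> R)
    (g : I -> 'rV[R]_m -> R) (x v : 'rV[R]_m) :
  (forall i, derivable (g i) x v) ->
  is_derive x v (fun y => \sum_(i <- s) c i * g i y)
    (\sum_(i <- s) c i * 'D_v (g i) x).
Proof.
move=> dg; elim: s => [|i s IHs].
  by under eq_fun do rewrite big_nil; rewrite big_nil; apply: is_derive_cst.
under eq_fun do rewrite big_cons; rewrite big_cons.
by apply: is_deriveD; apply: is_deriveZ; apply: derivableP.
Qed.

Lemma linear_cliffordE (L : {linear Cl -> Cl}) a A :
  L a A = \sum_B L (cbasis R B) A * a B.
Proof.
rewrite {1}[a]clifford_sum linear_sum sum_ffunE; apply: eq_bigr => B _.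
by rewrite linearZ ffunE mulrC.
Qed.

Variable L : {linear Cl -> Cl}.

Lemma cCk_linear k f : cCk k Omega f -> cCk k Omega (fun x => L (f x)).
Proof.
move=> f_Ck A; under eq_fun do rewrite linear_cliffordE.
exact: is_Ck_sum.
Qed.

Lemma cpartial_linear f i x : cCk 1 Omega f -> Omega x ->
  cpartial i (fun y => L (f y)) x = L (cpartial i f x).
Proof.
move=> f_C1 Ox; apply/ffunP => A; rewrite ffunE linear_cliffordE.
under eq_fun do rewrite linear_cliffordE.
under [RHS]eq_bigr do rewrite ffunE.
apply: derive_val; apply: is_derive_linear_comb => B.
by have [_ /(_ i) [+ _]] := f_C1 B; apply.
Qed.

Lemma cCkS k f : cCk k.+1 Omega f -> cCk 1 Omega f.
Proof.
move=> f_Ck A; have [f_cont df] := f_Ck A; split=> // i.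
by have [df_ex df_Ck] := df i; split=> //; split=> //; case: k df_Ck {f_Ck df} => [|k] [].
Qed.

Lemma cCk_cpartial k i f : cCk k.+1 Omega f -> cCk k Omega (cpartial i f).
Proof.
move=> f_Ck A; have [_ /(_ i) [_ +]] := f_Ck A.
by congr is_Ck; apply/funext => x; rewrite ffunE.
Qed.

Lemma cpartial_eq f1 f2 i x : (forall y, Omega y -> f1 y = f2 y) -> Omega x ->
  cpartial i f1 x = cpartial i f2 x.
Proof.
move=> f12 Ox; apply/ffunP => A; rewrite !ffunE; apply: near_eq_derive.
by apply: near_open => // y /f12 ->.
Qed.

Lemma cpartial2_linear f i j x : cCk 2 Omega f -> Omega x ->
  cpartial i (cpartial j (fun y => L (f y))) x = L (cpartial i (cpartial j f) x).
Proof.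
move=> f_C2 Ox; rewrite -cpartial_linear //; last exact: cCk_cpartial.
by apply: cpartial_eq => // y Oy; apply: cpartial_linear => //; apply: cCkS f_C2.
Qed.

(** Schwarz's theorem, coordinate by coordinate. *)
Lemma cpartialC f i j x : cCk 2 Omega f -> Omega x ->
  cpartial i (cpartial j f) x = cpartial j (cpartial i f) x.
Proof.
move=> f_C2 Ox; apply/ffunP => A.
have E k l : cpartial k (cpartial l f) x A =
    'D_(delta_mx 0 k) ('D_(delta_mx 0 l) (fun y => f y A)) x.
  rewrite ffunE; congr ('D_(delta_mx 0 k) _ x).
  by apply/funext => y; rewrite ffunE.
apply: etrans (E i j) (etrans _ (esym (E j i))).
have [_ df] := f_C2 A; have [df_i [_ ddf_i]] := df i; have [df_j [_ ddf_j]] := df j.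
apply: (mixed_deriveC Omega_open Ox) => [y Oy|y Oy||].
- by split; [apply: df_j|apply: df_i].
- by split; [apply: (ddf_j i).1|apply: (ddf_i j).1].
- exact: (ddf_j i).2.1.
- exact: (ddf_i j).2.1.
Qed.
End SmoothFunctions.

(** * Structural sets *)

Section StructuralSets.
Variables (R : realType) (m : nat).
Implicit Types (phi psi : 'I_m -> 'rV[R]_m).

Lemma structural_set_clifford phi :
  structural_set phi -> clifford_family (fun i => cvec (phi i)).
Proof. by move=> [_ phi_orth] i j; rewrite cvecM_anticomm phi_orth. Qed.

Lemma sum_Psi_parity phi psi (o : bool) a :
  \sum_(k < m.+1 | odd k == o) Psi phi psi k a =
  parity_Psi (fun i => cvec (phi i)) (fun i => cvec (psi i)) o a.
Proof.
rewrite /parity_Psi (partition_big (fun A : {set 'I_m} => inord #|A| : 'I_m.+1)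
  (fun k : 'I_m.+1 => odd k == o)) /= => [|A].
  apply: eq_bigr => k k_o; apply: eq_bigl => A.
  have A_le : (#|A| < m.+1)%N by rewrite ltnS -[m in leqRHS]card_ord max_card.
  rewrite -val_eqE /= inordK //.
  by case: eqP => [->|]; rewrite ?k_o ?andbF.
by rewrite inordK // ltnS -[m in leqRHS]card_ord max_card.
Qed.

Lemma parity_Psi_harmonic_infra phi psi (Omega : set 'rV[R]_m) f (o : bool) :
  structural_set phi -> structural_set psi -> open Omega ->
  inframonogenic phi psi Omega f ->
  let g x := parity_Psi (fun i => cvec (phi i)) (fun i => cvec (psi i)) o (f x) in
  harmonic_on Omega g /\ inframonogenic phi psi Omega g.
Proof.
move=> /structural_set_clifford phi_cliff /structural_set_clifford psi_cliff.
move=> Oo [f_C2 f_infra] g.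
have g_C2 : cCk 2 Omega g by apply: cCk_linear.
have psi_rev i : crev (cvec (psi i)) = cvec (psi i) by apply: crev_cvec.
have g2 x i j : Omega x ->
    cpartial i (cpartial j g) x =
    parity_Psi (fun i => cvec (phi i)) (fun i => cvec (psi i)) o
      (cpartial i (cpartial j f) x).
  exact: cpartial2_linear.
have f2_sym x i j : Omega x ->
    cpartial i (cpartial j f) x = cpartial j (cpartial i f) x.
  by move=> Ox; apply: cpartialC f_C2 Ox.
split; (split; first exact: g_C2) => x Ox.
  apply: etrans (eq_bigr _ (fun i _ => g2 x i i Ox)) _.
  exact: (parity_Psi_trace phi_cliff psi_cliff psi_rev
    (fun i j => f2_sym x i j Ox) (f_infra x Ox)).
apply: etrans (parity_Psi_infra phi_cliff psi_cliff psi_rev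
  (fun i j => f2_sym x i j Ox) (f_infra x Ox) o).
by apply: eq_bigr => i _; apply: eq_bigr => j _; congr (_ * _ * _); apply: g2.
Qed.

End StructuralSets.

Theorem theorem3p3 (R : realType) (m : nat) (phi psi : 'I_m -> 'rV[R]_m)
    (Omega : set 'rV[R]_m) (f : 'rV[R]_m -> clifford R m)
    (hphi : structural_set phi) (hpsi : structural_set psi)
    (hopen : open Omega) (hconn : connected Omega)
    (hf : inframonogenic phi psi Omega f) :
  (harmonic_on Omega (fun x => Psi_plus phi psi (f x)) /\
   inframonogenic phi psi Omega (fun x => Psi_plus phi psi (f x))) /\
  (harmonic_on Omega (fun x => Psi_minus phi psi (f x)) /\
   inframonogenic phi psi Omega (fun x => Psi_minus phi psi (f x))).
Proof.
have plusE : (fun x => Psi_plus phi psi (f x)) = (fun x =>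
    parity_Psi (fun i => cvec (phi i)) (fun i => cvec (psi i)) false (f x)).
  apply/funext => x; rewrite -sum_Psi_parity /Psi_plus.
  by apply: eq_bigl => k; rewrite eqbF_neg.
have minusE : (fun x => Psi_minus phi psi (f x)) = (fun x =>
    parity_Psi (fun i => cvec (phi i)) (fun i => cvec (psi i)) true (f x)).
  apply/funext => x; rewrite -sum_Psi_parity /Psi_minus.
  by apply: eq_bigl => k; rewrite eqb_id.
by rewrite plusE minusE; split; apply: parity_Psi_harmonic_infra.
Qed.
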